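(* Let $\chi$ and $\check\phi$ be formulas over $\vec{x}$, $\vec{a}:\mathbb{Z}^d\to\mathbb{Z}^d$, and $\mathit{mf}:\mathbb{Z}^d\to\mathbb{Q}$ such that for all $\vec{x}\in\mathbb{Z}^d$: $\check\phi(\vec{x})\land\chi(\vec{x})\implies \mathit{mf}(\vec{x})-\mathit{mf}(\vec{a}(\vec{x}))\le 1$, and $\check\phi(\vec{x})\land\neg\chi(\vec{x})\implies\mathit{mf}(\vec{x})\le 0$. Then the conditional acceleration technique $(\langle\chi,\vec{a}\rangle,\check\phi)\mapsto \vec{x}'=\vec{a}^n(\vec{x})\land\chi(\vec{x})\land n<\mathit{mf}(\vec{x})+1$ is sound. Explicitly: for all $\vec{x},\vec{x}'\in\mathbb{Z}^d$ and $n>0$, if $\vec{x}\longrightarrow^n_{\langle\check\phi,\vec{a}\rangle}\vec{x}'$, $\vec{x}'=\vec{a}^n(\vec{x})$, $\chi(\vec{x})$ and $n<\mathit{mf}(\vec{x})+1$, then $\vec{x}\longrightarrow^n_{\langle\chi,\vec{a}\rangle}\vec{x}'$.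
   Context: $\vec{x}=(x_1,\dots,x_d)$ ranges over $\mathbb{Z}^d$, $n$ is a variable, $\vec{x}'=(x_1',\dots,x_d')$. Formulas are finite quantifier-free propositional formulas with atoms $p>0$, $p$ a closed-form arithmetic expression. For a formula $\phi$ over $\vec{x}$ and $\vec{a}:\mathbb{Z}^d\to\mathbb{Z}^d$, the loop $\langle\phi,\vec{a}\rangle$ induces $\vec{x}\longrightarrow_{\langle\phi,\vec{a}\rangle}\vec{x}'$ iff $\phi(\vec{x})\land\vec{x}'=\vec{a}(\vec{x})$; $\longrightarrow^n$ is its $n$-fold composition, and $\vec{a}^n$ is the $n$-fold application of $\vec{a}$ ($\vec{a}^0=\mathrm{id}$). A conditional acceleration technique is a partial function $\mathit{accel}$ mapping pairs (loop $\langle\chi,\vec{a}\rangle$, formula $\check\phi$) to formulas over $(\vec{x},n,\vec{x}')$; it is sound if for all arguments in its domain, $\vec{x},\vec{x}'\in\mathbb{Z}^d$, $n>0$: $\vec{x}\longrightarrow^n_{\langle\check\phi,\vec{a}\rangle}\vec{x}'\land\mathit{accel}(\langle\chi,\vec{a}\rangle,\check\phi)$ implies $\vec{x}\longrightarrow^n_{\langle\chi,\vec{a}\rangle}\vec{x}'$. *)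

(* Defs.v *)
From mathcomp Require Import all_boot all_order all_algebra.
Set Implicit Arguments.
Unset Strict Implicit.
Unset Printing Implicit Defensive.
Import Order.TTheory GRing.Theory Num.Theory.
Local Open Scope ring_scope.

(* An arithmetic expression p is represented by its value function on *)
(* environments.  All functions are allowed, since the class of closed forms *)
(* is open-ended and since mf and the iterates of the update have to occur in *)
(* formulas as well.  R is the field in which expressions take their values, *)
(* for instance the rationals or the reals. *)
Inductive formula (R : realFieldType) (env : Type) : Type :=
| FTrue
| FAtom of env -> R (* p > 0 *)
| FNot of formula R env
| FAnd of formula R env & formula R env
| FOr of formula R env & formula R env.

Arguments FTrue {R env}.

Fixpoint sat (R : realFieldType) (env : Type) (phi : formula R env) (e : env)
    : bool :=
  match phi with
  | FTrue => true
  | FAtom p => 0 < p e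
  | FNot phi1 => ~~ sat phi1 e
  | FAnd phi1 phi2 => sat phi1 e && sat phi2 e
  | FOr phi1 phi2 => sat phi1 e || sat phi2 e
  end.

Fixpoint pullback (R : realFieldType) (env env' : Type) (f : env' -> env)
    (phi : formula R env) : formula R env' :=
  match phi with
  | FTrue => FTrue
  | FAtom p => FAtom (fun e => p (f e))
  | FNot phi1 => FNot (pullback f phi1)
  | FAnd phi1 phi2 => FAnd (pullback f phi1) (pullback f phi2)
  | FOr phi1 phi2 => FOr (pullback f phi1) (pullback f phi2)
  end.

Definition state (d : nat) := 'rV[int]_d.

(* Valuations of the variables (x, n, x') of an accelerated formula. *)
Record accel_env (d : nat) :=
  AccelEnv { pre : state d; iterations : nat; post : state d }.

Record loop (R : realFieldType) (d : nat) :=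
  Loop { guard : formula R (state d); update : state d -> state d }.

Definition step (R : realFieldType) (d : nat) (l : loop R d) (x x' : state d)
    : Prop :=
  sat (guard l) x /\ x' = update l x.

Fixpoint rel_iter (T : Type) (r : T -> T -> Prop) (n : nat) (x x' : T) : Prop :=
  match n with
  | 0 => x' = x
  | m.+1 => exists2 y, r x y & rel_iter r m y x'
  end.

(* A partial function from pairs (loop, formula over x) to formulas over *)
(* (x, n, x'). *)
Record cond_accel (R : realFieldType) (d : nat) := CondAccel {
  accel_dom : loop R d -> formula R (state d) -> Prop;
  accel : forall (l : loop R d) (phi : formula R (state d)),
      accel_dom l phi -> formula R (accel_env d) }.

Definition sound (R : realFieldType) (d : nat) (T : cond_accel R d) : Prop :=
  forall (l : loop R d) (phic : formula R (state d)) (D : accel_dom T l phic)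
         (x x' : state d) (n : nat),
    (0 < n)%N ->
    rel_iter (step (Loop phic (update l))) n x x' /\
      sat (accel D) (AccelEnv x n x') ->
    rel_iter (step l) n x x'.

(* u = v as a conjunction over the coordinates; each equation u_i = v_i is *)
(* expressed by the strict inequalities between u_i and v_i both failing. *)
Definition FEq (R : realFieldType) (env : Type) (d : nat) (u v : env -> state d)
    : formula R env :=
  \big[@FAnd R env/FTrue]_(i < d)
    FAnd (FNot (FAtom (fun e => (u e 0 i - v e 0 i)%:~R)))
         (FNot (FAtom (fun e => (v e 0 i - u e 0 i)%:~R))).

Definition metering_formula (R : realFieldType) (d : nat)
    (chi : formula R (state d)) (a : state d -> state d) (mf : state d -> rat)
    : formula R (accel_env d) :=
  FAnd (FEq R (@post d) (fun e => iter (iterations e) a (pre e)))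
    (FAnd (pullback (@pre d) chi)
       (FAtom (fun e => ratr (mf (pre e)) + 1 - (iterations e)%:R))).

(* mf is chosen for given chi, a and phic, so (<chi, a>, phic) is the only *)
(* argument in the domain of this technique. *)
Definition metering_accel (R : realFieldType) (d : nat)
    (chi : formula R (state d)) (a : state d -> state d)
    (phic : formula R (state d)) (mf : state d -> rat) : cond_accel R d :=
  @CondAccel R d (fun l phi => l = Loop chi a /\ phi = phic)
    (fun _ _ _ => metering_formula chi a mf).

(* Main.v *)
Require Import Defs.
From mathcomp Require Import all_boot all_order all_algebra.
Set Implicit Arguments.
Unset Strict Implicit.
Unset Printing Implicit Defensive.
Import Order.TTheory GRing.Theory Num.Theory.
Local Open Scope ring_scope.

(** Along a [phic]-run, [mf] bounds from below the number of steps before [chi] can fail. Induction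
    on the run length, for all start states, keeps the remaining length below [mf x + 1]. Both
    claims of the theorem are instances of [rel_iter_metering]. *)

(* If chi fails then mf x <= 0, which the bound on n > 0 excludes; if chi holds
   then one step lowers mf by at most 1, so the bound survives for n - 1. *)
Lemma rel_iter_metering (R : realFieldType) (d : nat)
    (chi phic : formula R (state d)) (a : state d -> state d)
    (mf : state d -> rat)
    (mf_decr : forall x : state d,
        sat phic x /\ sat chi x -> mf x - mf (a x) <= 1)
    (mf_bound : forall x : state d,
        sat phic x /\ ~ sat chi x -> mf x <= 0)
    (n : nat) (x x' : state d) :
  rel_iter (step (Loop phic a)) n x x' ->
  n%:R < mf x + 1 ->
  rel_iter (step (Loop chi a)) n x x'.
Proof.
elim: n x => [//|n IHn] x /= [y [/= phic_x ->] phic_iter].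
(* For length [n.+1] the bound becomes [n < mf x], so [mf x] is positive. *)
rewrite -natr1 ltrD2r => lt_n_mf.
have chi_x : sat chi x.
  apply/negP => not_chi_x.
  have := lt_le_trans lt_n_mf (mf_bound x (conj phic_x not_chi_x)).
  by rewrite ltNge ler0n.
exists (a x) => //; apply: IHn => //.
by apply: lt_le_trans lt_n_mf _; rewrite addrC -lerBlDr mf_decr.
Qed.

Theorem theorem9 (R : realFieldType) (d : nat)
    (chi phic : formula R (state d)) (a : state d -> state d)
    (mf : state d -> rat)
    (mf_decr : forall x : state d,
        sat phic x /\ sat chi x -> mf x - mf (a x) <= 1)
    (mf_bound : forall x : state d,
        sat phic x /\ ~ sat chi x -> mf x <= 0) :
  sound (metering_accel chi a phic mf) /\
  (forall (x x' : state d) (n : nat), (0 < n)%N ->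
     rel_iter (step (Loop phic a)) n x x' ->
     x' = iter n a x ->
     sat chi x ->
     n%:R < mf x + 1 ->
     rel_iter (step (Loop chi a)) n x x').
Proof.
split=> [l psi D x x' n _ [phic_iter /and3P[_ _ /=]]
        | x x' n _ phic_iter _ _]; last first.
  exact: (rel_iter_metering mf_decr mf_bound phic_iter).
(* The atom compares values in [R]; since [ratr] is an order-preserving morphism, this is the bound
   on [n] over [rat]. *)
rewrite -(ratr_nat R) -(rmorph1 (ratr : rat -> R)) -rmorphD subr_gt0 ltr_rat.
case: D phic_iter => -> -> /=.
exact: (rel_iter_metering mf_decr mf_bound).
Qed.
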